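(* Consider the Singleton Search Engine Game with $\beta=1$ and the proportional selection rule. 1. For every $K\ge2$ there are instances with $K$ engines in which the (pure) Price of Stability is at least $K$. 2. There are instances with only two engines ($K=2$) in which the (pure) Price of Stability is $\Omega(\sqrt N)$, where $N$ is the number of pages; that is, there are constants $c>0$ and $N_0$ such that for every $N\ge N_0$ there is an instance with $K=2$ engines and $N$ pages whose Price of Stability is at least $c\sqrt N$.
   Context: Proportional selection rule: $f_i(\mathbf q)=\frac{q_i}{\sum_j q_j}$ for $\mathbf q\in[0,1]^K\setminus\{\mathbf 0\}$, and $f_i(\mathbf 0)=1/K$. Singleton Search Engine Game: there are $K$ engines, $N$ pages $\{1,\dots,N\}$, and a probability distribution $\gamma$ on pages with $\gamma(n)>0$ for all $n$; a user of type $n$ (probability $\gamma(n)$) desires exactly page $n$ and looks only at the first displayed page. A pure strategy of engine $i$ is a probability vector $\mathbf q_i=(q_i(n))_{n=1}^N$, where $q_i(n)$ is the probability of displaying page $n$. With $\mathbf q(n)=(q_1(n),\dots,q_K(n))$ and parameter $\beta\in[0,1]$, engine $i$'s payoff is $\sum_n\gamma(n)f_i(\mathbf q(n))(\beta+(1-\beta)q_i(n))$ (for $\beta=1$: $\sum_n\gamma(n)f_i(\mathbf q(n))$), and the welfare is $W=\sum_n\gamma(n)\sum_i f_i(\mathbf q(n))q_i(n)$. A pure Nash equilibrium is a profile of pure strategies from which no engine can strictly improve her payoff by a unilateral deviation to another pure strategy. With $\mathrm{OPT}$ a welfare-maximizing strategy profile, the (pure) Price of Stability is the infimum of $W(\mathrm{OPT})/W(\mathbf{\mathcal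 D})$ over pure Nash equilibria $\mathbf{\mathcal D}$. An instance is a choice of $K$, $N$ and $\gamma$. *)

(* Defs.v *)
From HB Require Import structures.
From mathcomp Require Import all_boot all_order all_algebra.
From mathcomp Require Import all_classical all_reals ereal.

Set Implicit Arguments.
Unset Strict Implicit.
Unset Printing Implicit Defensive.

Import Order.TTheory GRing.Theory Num.Theory.

Local Open Scope classical_set_scope.
Local Open Scope ring_scope.

(* Engines are indexed by 'I_K, pages by 'I_N. *)

Definition proportional (R : realType) (K : nat) (q : 'I_K -> R) (i : 'I_K) : R :=
  if [forall j, q j == 0] then K%:R^-1 else q i / \sum_(j < K) q j.

Definition prob_vector (R : realType) (N : nat) (s : 'I_N -> R) : Prop :=
  (forall n, 0 <= s n) /\ \sum_(n < N) s n = 1.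

Definition user_distribution (R : realType) (N : nat) (gamma : 'I_N -> R) : Prop :=
  (forall n, 0 < gamma n) /\ \sum_(n < N) gamma n = 1.

Definition profile (R : realType) (K N : nat) : Type := 'I_K -> 'I_N -> R.

Definition is_profile (R : realType) (K N : nat) (q : profile R K N) : Prop :=
  forall i, prob_vector (q i).

(* q(n) = (q_1(n), ..., q_K(n)) *)
Definition at_page (R : realType) (K N : nat) (q : profile R K N) (n : 'I_N) :
  'I_K -> R := fun i => q i n.

Definition payoff (R : realType) (K N : nat) (beta : R) (gamma : 'I_N -> R)
    (q : profile R K N) (i : 'I_K) : R :=
  \sum_(n < N)
    gamma n * proportional (at_page q n) i * (beta + (1 - beta) * q i n).

Definition welfare (R : realType) (K N : nat) (gamma : 'I_N -> R)
    (q : profile R K N) : R :=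
  \sum_(n < N) gamma n * \sum_(i < K) proportional (at_page q n) i * q i n.

Definition pure_Nash (R : realType) (K N : nat) (beta : R) (gamma : 'I_N -> R)
    (q : profile R K N) : Prop :=
  is_profile q /\
  forall (i : 'I_K) (s : 'I_N -> R), prob_vector s ->
    payoff beta gamma [eta q with i |-> s] i <= payoff beta gamma q i.

Definition welfare_maximizing (R : realType) (K N : nat) (gamma : 'I_N -> R)
    (opt : profile R K N) : Prop :=
  is_profile opt /\
  forall q : profile R K N, is_profile q -> welfare gamma q <= welfare gamma opt.

(* The value is the same for every welfare-maximizing [opt].  It is +oo when
   there is no pure Nash equilibrium, so a lower bound on it is only
   meaningful together with the existence of an equilibrium. *)
Definition price_of_stability (R : realType) (K N : nat) (beta : R)
    (gamma : 'I_N -> R) (opt : profile R K N) : \bar R :=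
  ereal_inf [set (welfare gamma opt / welfare gamma D)%:E
            | D in [set D : profile R K N | pure_Nash beta gamma D]].

(* Main.v *)
(* If engine [i] plays [gamma], Jensen's inequality for x |-> 1/x guarantees
   her a payoff of at least 1/K against any opponents, with equality only if
   the column sums of the resulting profile are K * gamma.  Payoffs always sum
   to 1, so in an equilibrium every engine gets exactly 1/K and all these
   equalities hold; hence the only equilibrium is "everybody plays [gamma]",
   with welfare sum gamma^2.  The optimum lets distinct engines show distinct
   top pages.  Part 1 takes gamma uniform on K pages (optimum 1, equilibrium
   1/K).  Part 2, with s = sqrt N, takes one page of weight 1/s and all others
   of weight 1/(s(s+1)): optimum (s+2)/(s(s+1)), equilibrium 2/(s(s+1)). *)
Require Import Defs.
From HB Require Import structures.
From mathcomp Require Import all_boot all_order all_algebra.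
From mathcomp Require Import all_classical all_reals ereal.
From mathcomp Require Import ring lra.

Set Implicit Arguments.
Unset Strict Implicit.
Unset Printing Implicit Defensive.

Import Order.TTheory GRing.Theory Num.Theory.

Local Open Scope ring_scope.

(** * The proportional rule and payoffs *)

Lemma sum_ord_const (R : realType) (K : nat) (x : R) :
  \sum_(i < K) x = K%:R * x.
Proof. by rewrite sumr_const card_ord mulr_natl. Qed.

Lemma proportionalE (R : realType) (K : nat) (q : 'I_K -> R) (i : 'I_K) :
  0 < \sum_j q j -> proportional q i = q i / \sum_j q j.
Proof.
move=> T_gt0; rewrite /proportional; case: forallP => // q0.
by move: T_gt0; rewrite big1 ?ltxx// => j _; apply/eqP.
Qed.

(** For nonnegative [q] this dichotomy matches the two branches of [proportional]. *)
Lemma sum_eq0_or_gt0 (R : realType) (K : nat) (q : 'I_K -> R) :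
  (forall j, 0 <= q j) -> (forall j, q j == 0) \/ 0 < \sum_j q j.
Proof.
move=> q_ge0; have [s0|s0] := eqVneq (\sum_j q j) 0.
  by left=> j; apply/eqP; apply: (psumr_eq0P (P := predT)).
by right; rewrite lt0r s0 sumr_ge0.
Qed.

Lemma proportional_ge0 (R : realType) (K : nat) (q : 'I_K -> R) (i : 'I_K) :
  (forall j, 0 <= q j) -> 0 <= proportional q i.
Proof.
move=> q_ge0; rewrite /proportional; case: ifP => _.
  by rewrite invr_ge0 ler0n.
by rewrite divr_ge0// sumr_ge0.
Qed.

Lemma sum_proportional (R : realType) (K : nat) (q : 'I_K -> R) :
  (0 < K)%N -> (forall j, 0 <= q j) -> \sum_i proportional q i = 1.
Proof.
move=> K_gt0 q_ge0; have [/forallP q0|T_gt0] := sum_eq0_or_gt0 q_ge0.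
  rewrite /proportional q0 sum_ord_const mulfV//.
  by rewrite pnatr_eq0 -lt0n.
under eq_bigr do rewrite proportionalE//.
by rewrite -mulr_suml divff// gt_eqF.
Qed.

Lemma proportional_le1 (R : realType) (K : nat) (q : 'I_K -> R) (i : 'I_K) :
  (forall j, 0 <= q j) -> proportional q i <= 1.
Proof.
move=> q_ge0; rewrite -(sum_proportional (leq_trans _ (ltn_ord i)) q_ge0)//.
by rewrite (bigD1 i)//= lerDl sumr_ge0// => j _; exact: proportional_ge0.
Qed.

Lemma prob_vector_le1 (R : realType) (N : nat) (s : 'I_N -> R) (n : 'I_N) :
  prob_vector s -> s n <= 1.
Proof. by case=> s_ge0 <-; rewrite (bigD1 n)//= lerDl sumr_ge0. Qed.

Lemma payoff1E (R : realType) (K N : nat) (gamma : 'I_N -> R)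
    (q : profile R K N) (i : 'I_K) :
  payoff 1 gamma q i = \sum_n gamma n * proportional (at_page q n) i.
Proof. by apply: eq_bigr => n _; rewrite subrr mul0r addr0 mulr1. Qed.

Lemma sum_payoff1 (R : realType) (K N : nat) (gamma : 'I_N -> R)
    (q : profile R K N) :
  (0 < K)%N -> user_distribution gamma -> is_profile q ->
  \sum_i payoff 1 gamma q i = 1.
Proof.
move=> K_gt0 [_ g1] qP; under eq_bigr do rewrite payoff1E.
rewrite exchange_big -g1; apply: eq_bigr => n _ /=.
by rewrite -mulr_sumr sum_proportional ?mulr1// => j; exact: (qP j).1.
Qed.

(** * Uniqueness and existence of the equilibrium *)

Lemma user_distribution_prob_vector (R : realType) (N : nat)
    (gamma : 'I_N -> R) : user_distribution gamma -> prob_vector gamma.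
Proof. by case=> g_gt0 g1; split=> // n; exact: ltW. Qed.

Lemma is_profile_deviation (R : realType) (K N : nat) (q : profile R K N)
    (i : 'I_K) (s : 'I_N -> R) :
  is_profile q -> prob_vector s -> is_profile [eta q with i |-> s].
Proof. by move=> qP sP j /=; case: eqP. Qed.

Lemma sum_at_page (R : realType) (K N : nat) (q : profile R K N) :
  is_profile q -> \sum_(n < N) \sum_(i < K) q i n = K%:R.
Proof.
move=> qP; rewrite exchange_big /=.
under eq_bigr => i _ do rewrite (qP i).2.
by rewrite sumr_const card_ord.
Qed.

(* The sum is the defect in Jensen's inequality, coming from the tangent of
   1/x at x = K. *)
Lemma payoff1_gamma (R : realType) (K N : nat) (gamma : 'I_N -> R)
    (q : profile R K N) (i : 'I_K) :
  user_distribution gamma -> is_profile q -> q i = gamma ->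
  payoff 1 gamma q i = K%:R^-1 +
    \sum_n (\sum_j q j n - K%:R * gamma n) ^+ 2 /
             (K%:R ^+ 2 * \sum_j q j n).
Proof.
move=> [g_gt0 g1] qP qi.
have K_neq0 : K%:R != 0 :> R.
  by rewrite pnatr_eq0 -lt0n (leq_trans _ (ltn_ord i)).
have T_gt0 n : 0 < \sum_j q j n.
  rewrite (bigD1 i)//= qi ltr_pwDl// sumr_ge0// => j _.
  by case: (qP j).
(* The tangent 2/K - x/K^2 taken at x = T/gamma, with T the column sum, and averaged with weights
   [gamma]: the comparison can now be made page by page. *)
have -> : K%:R^-1 = 2 / K%:R * (\sum_n gamma n)
                    - K%:R ^- 2 * \sum_n \sum_j q j n :> R.
  by rewrite g1 sum_at_page//; field.
rewrite payoff1E !mulr_sumr -sumrB -big_split/=; apply: eq_bigr => n _.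
rewrite proportionalE ?T_gt0// /at_page qi.
by have /lt0r_neq0 := T_gt0 n; move: (\sum_j q j n) => T T0; field; rewrite T0.
Qed.

Lemma pure_Nash_eq (R : realType) (K N : nat) (gamma : 'I_N -> R)
    (q : profile R K N) :
  (1 < K)%N -> user_distribution gamma -> pure_Nash 1 gamma q ->
  forall i n, q i n = gamma n.
Proof.
move=> K_gt1 gP [qP qN].
have K_gt0 : (0 < K)%N by exact: ltnW.
have K_neq0 : K%:R != 0 :> R by rewrite pnatr_eq0 -lt0n.
pose dev i : profile R K N := [eta q with i |-> gamma].
have devP i : is_profile (dev i).
  exact/is_profile_deviation/user_distribution_prob_vector.
have devi i : dev i i = gamma by rewrite /dev /= eqxx.
pose defect i n := (\sum_j dev i j n - K%:R * gamma n) ^+ 2 /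
                    (K%:R ^+ 2 * \sum_j dev i j n).
have T_gt0 i n : 0 < \sum_j dev i j n.
  rewrite (bigD1 i)//= devi ltr_pwDl//; first by case: gP.
  by rewrite sumr_ge0// => j _; case: (devP i j).
have defect_ge0 i n : 0 <= defect i n.
  by rewrite divr_ge0 ?sqr_ge0// mulr_ge0 ?sqr_ge0// ltW.
have devE i : payoff 1 gamma (dev i) i = K%:R^-1 + \sum_n defect i n.
  exact: payoff1_gamma.
(* Each deviation pays at most the equilibrium payoff. The latter sum to 1, and K copies of 1/K
   already use that up, so nothing is left for the defects. *)
have sum_defect : \sum_i \sum_n defect i n <= 0.
  have : \sum_i payoff 1 gamma (dev i) i <= \sum_i payoff 1 gamma q i.
    by apply: ler_sum => i _; apply/qN/user_distribution_prob_vector.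
  rewrite sum_payoff1//; under eq_bigr do rewrite devE.
  by rewrite big_split/= sum_ord_const mulfV// gerDl.
have defect0 i n : defect i n = 0.
  have s_ge0 j : 0 <= \sum_m defect j m by exact: sumr_ge0.
  have s0 : \sum_j \sum_m defect j m = 0.
    by apply/eqP; rewrite eq_le sum_defect sumr_ge0.
  have si0 : \sum_m defect i m = 0.
    exact: (psumr_eq0P (fun j _ => s_ge0 j) s0).
  exact: (psumr_eq0P (fun m _ => defect_ge0 i m) si0).
(* A zero defect forces the column sum after engine [i] deviates to be K * gamma. *)
have opp i n : \sum_j q j n - q i n + gamma n = K%:R * gamma n.
  have /eqP := defect0 i n; rewrite /defect mulf_eq0 sqrf_eq0 invr_eq0.
  rewrite [X in _ || X]mulf_eq0 sqrf_eq0 (negbTE K_neq0) (gt_eqF (T_gt0 i n)).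
  rewrite !orbF subr_eq0.
  move=> /eqP <-; rewrite (bigD1 i)//= [RHS](bigD1 i)//= devi.
  rewrite [X in X + _ = _]addrAC subrr add0r addrC.
  congr (_ + _); apply: eq_bigr => j ji.
  by rewrite /dev /= (negbTE ji).
move=> i n.
(* Summing these K equations gives (K - 1) T = (K - 1) K gamma, so T = K * gamma as K > 1; then
   equation [i] yields q_i = gamma. *)
have : \sum_j (\sum_k q k n - q j n + gamma n) = \sum_(j < K) K%:R * gamma n.
  by apply: eq_bigr => j _; exact: opp.
rewrite big_split sumrB/= !sum_ord_const => eqT.
have := opp i n; move: eqT; set T := \sum_k q k n => eqT oppi.
have K1_neq0 : K%:R - 1 != 0 :> R by rewrite subr_eq0 (eqr_nat R K 1) gtn_eqF.
have TE : T = K%:R * gamma n.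
  apply: (mulfI K1_neq0); apply/eqP; rewrite -subr_eq0; apply/eqP.
  by move: eqT => /eqP; rewrite -subr_eq0 => /eqP <-; ring.
by move: oppi; rewrite TE; lra.
Qed.

(** Against opponents playing [gamma], the payoff is concave in the deviation [s], hence below its
    tangent at s = gamma. The tangent has the same slope (K - 1)/K^2 on every page, and [s] and
    [gamma] have equal sums, so the linear terms cancel and the bound is 1/K. *)
Lemma pure_Nash_gamma (R : realType) (K N : nat) (gamma : 'I_N -> R) :
  (1 < K)%N -> user_distribution gamma ->
  pure_Nash 1 gamma (fun _ : 'I_K => gamma).
Proof.
move=> K_gt1 gP; have [g_gt0 g1] := gP.
have gprob := user_distribution_prob_vector gP.
split=> [i //|i s [s_ge0 s1]].
have K_gt1R : 1 < K%:R :> R by rewrite (ltr_nat R 1).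
have K_neq0 : K%:R != 0 :> R by lra.
rewrite !payoff1E.
have -> : \sum_n gamma n * proportional (at_page (fun=> gamma) n) i = K%:R^-1.
  rewrite -[RHS]mul1r -[X in _ = X * _]g1 mulr_suml; apply: eq_bigr => n _.
  have T_gt0 : 0 < \sum_(j < K) gamma n.
    by rewrite sum_ord_const mulr_gt0// (lt_trans ltr01).
  rewrite proportionalE// /at_page sum_ord_const.
  by have := lt0r_neq0 (g_gt0 n) => g0; field; rewrite K_neq0.
have -> : K%:R^-1 = \sum_n (gamma n / K%:R
                     + (K%:R - 1) / K%:R ^+ 2 * (s n - gamma n)) :> R.
  by rewrite big_split/= -mulr_suml -mulr_sumr sumrB g1 s1; field.
apply: ler_sum => n _; set q := at_page _ n.
have sE : \sum_j q j = s n + (K%:R - 1) * gamma n.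
  rewrite (bigD1 i)//= /q /at_page /= eqxx; congr (_ + _).
  rewrite (eq_bigr (fun=> gamma n)) => [|j /negbTE -> //].
  by rewrite sumr_const cardC1 card_ord -subn1 -[LHS]mulr_natl natrB// ltnW.
have T_gt0 : 0 < s n + (K%:R - 1) * gamma n.
  by rewrite ltr_wpDl// mulr_gt0// subr_gt0.
rewrite proportionalE sE// {1}/q /at_page /= eqxx -subr_ge0.
(* The gap between tangent and payoff is a square over a positive denominator. *)
have -> : gamma n / K%:R + (K%:R - 1) / K%:R ^+ 2 * (s n - gamma n) -
    gamma n * (s n / (s n + (K%:R - 1) * gamma n)) =
    (K%:R - 1) * (s n - gamma n) ^+ 2 /
      (K%:R ^+ 2 * (s n + (K%:R - 1) * gamma n)).
  by field; rewrite K_neq0 lt0r_neq0.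
rewrite divr_ge0// mulr_ge0 ?sqr_ge0//; first by rewrite subr_ge0 ltW.
exact: ltW.
Qed.

(** * Equilibrium welfare and the price of stability *)

Lemma welfare_gamma (R : realType) (K N : nat) (gamma : 'I_N -> R)
    (q : profile R K N) :
  (0 < K)%N -> user_distribution gamma -> (forall i n, q i n = gamma n) ->
  welfare gamma q = \sum_n gamma n ^+ 2.
Proof.
move=> K_gt0 [g_gt0 _] qE; apply: eq_bigr => n _; rewrite expr2.
under eq_bigr do rewrite qE.
rewrite -mulr_suml sum_proportional ?mul1r// => j.
by rewrite /at_page qE ltW.
Qed.

(** All equilibria share the welfare [\sum_n gamma n ^+ 2], so the infimum ranges over a single
    quotient. *)
Lemma price_of_stability_ge (R : realType) (K N : nat) (gamma : 'I_N -> R)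
    (opt : profile R K N) (x : R) :
  (1 < K)%N -> user_distribution gamma ->
  x <= welfare gamma opt / \sum_n gamma n ^+ 2 ->
  (x%:E <= price_of_stability 1 gamma opt)%E.
Proof.
move=> K_gt1 gP xle; apply/ereal_infP => _ [q /= qN <-].
rewrite lee_fin (@welfare_gamma _ _ _ _ q)//; first exact: ltnW.
exact: pure_Nash_eq.
Qed.

(** * The optimal profile and upper bounds on welfare *)

Definition distinct_pages (R : realType) (K N : nat) (leKN : (K <= N)%N) :
  profile R K N := fun i n => (n == widen_ord leKN i)%:R.

Lemma is_profile_distinct_pages (R : realType) (K N : nat) (leKN : (K <= N)%N) :
  is_profile (distinct_pages R leKN).
Proof.
move=> i; split=> [n|]; first exact: ler0n.
rewrite (bigD1 (widen_ord leKN i))//= /distinct_pages eqxx big1 ?addr0// => n.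
by move=> /negbTE ->.
Qed.

Lemma welfare_distinct_pages (R : realType) (K N : nat) (leKN : (K <= N)%N)
    (gamma : 'I_N -> R) :
  welfare gamma (distinct_pages R leKN) = \sum_i gamma (widen_ord leKN i).
Proof.
rewrite /welfare; under eq_bigr do rewrite mulr_sumr.
rewrite exchange_big/=; apply: eq_bigr => i _.
(* On any other page the factor [q i n] is 0, which also covers pages shown by nobody, where the
   rule takes its default 1/K. *)
rewrite (bigD1 (widen_ord leKN i))//= big1 => [|n /negbTE ni]; last first.
  by rewrite /distinct_pages ni !mulr0.
have sE : \sum_j at_page (distinct_pages R leKN) (widen_ord leKN i) j = 1.
  rewrite (bigD1 i)//= big1 => [|j ji].
    by rewrite /at_page /distinct_pages eqxx addr0.
  by rewrite /at_page /distinct_pages -val_eqE /= eq_sym val_eqE (negbTE ji).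
by rewrite proportionalE sE// /at_page /distinct_pages eqxx divr1 !mulr1 addr0.
Qed.

(** The probability that a user of type [n] is satisfied. At most 1 on each page and at most K in
    total, these numbers obey the constraints of a fractional knapsack, whose optimum fills the
    heaviest pages. *)
Definition page_welfare (R : realType) (K N : nat) (q : profile R K N)
  (n : 'I_N) : R := \sum_i proportional (at_page q n) i * q i n.

Lemma page_welfare_le1 (R : realType) (K N : nat) (q : profile R K N)
    (n : 'I_N) :
  (0 < K)%N -> is_profile q -> page_welfare q n <= 1.
Proof.
move=> K_gt0 qP; have q_ge0 j : 0 <= at_page q n j by exact: (qP j).1.
rewrite -(sum_proportional K_gt0 q_ge0); apply: ler_sum => i _.
rewrite ler_piMr ?proportional_ge0//; exact: prob_vector_le1.
Qed.

Lemma sum_page_welfare_le (R : realType) (K N : nat) (q : profile R K N) :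
  is_profile q -> \sum_n page_welfare q n <= K%:R.
Proof.
move=> qP; rewrite -(sum_at_page qP); apply: ler_sum => n _.
apply: ler_sum => i _; have q_ge0 j : 0 <= q j n by case: (qP j).
by rewrite ler_piMl// proportional_le1.
Qed.

(** * The two families of instances *)

Lemma uniform_instance (R : realType) (K : nat) : (2 <= K)%N ->
  exists (N : nat) (gamma : 'I_N -> R),
    user_distribution gamma /\
    (exists D : profile R K N, pure_Nash 1 gamma D) /\
    exists opt : profile R K N,
      welfare_maximizing gamma opt /\
      (K%:R%:E <= price_of_stability 1 gamma opt)%E.
Proof.
move=> K_gt1; have K_gt0 : (0 < K)%N by exact: ltnW.
have KR_gt0 : 0 < K%:R :> R by rewrite ltr0n.
have K_neq0 := lt0r_neq0 KR_gt0.
pose gamma (n : 'I_K) : R := K%:R^-1.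
have sum_gamma : \sum_n gamma n = 1.
  by rewrite sum_ord_const mulfV.
have gP : user_distribution gamma by split=> // n; rewrite invr_gt0.
exists K, gamma; split=> //; split.
  by exists (fun=> gamma); exact: pure_Nash_gamma.
exists (distinct_pages R (leqnn K)).
(* With as many pages as engines, every user is served. *)
have optE : welfare gamma (distinct_pages R (leqnn K)) = 1.
  by rewrite welfare_distinct_pages.
split.
  split=> [|q qP]; first exact: is_profile_distinct_pages.
  rewrite optE -sum_gamma; apply: ler_sum => n _.
  by rewrite ler_piMr ?invr_ge0 ?ler0n//; exact: page_welfare_le1.
apply: price_of_stability_ge => //.
rewrite optE (eq_bigr (fun=> K%:R^-1 ^+ 2))// sum_ord_const.
by rewrite expr2 mulVKf // invrK mul1r.
Qed.

Lemma one_heavy_page_instance (R : realType) (N : nat) : (2 <= N)%N ->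
  exists gamma : 'I_N -> R,
    user_distribution gamma /\
    (exists D : profile R 2 N, pure_Nash 1 gamma D) /\
    exists opt : profile R 2 N,
      welfare_maximizing gamma opt /\
      ((2^-1 * Num.sqrt N%:R)%:E <= price_of_stability 1 gamma opt)%E.
Proof.
(* From here [N] counts the light pages only, so s^2 = N + 1. *)
case: N => [//|N] N_gt0; set s : R := Num.sqrt N.+1%:R.
have s_gt0 : 0 < s by rewrite sqrtr_gt0 ltr0n.
have s1_gt0 : 0 < s + 1 by rewrite ltr_wpDr.
have NE : N%:R = s ^+ 2 - 1 by rewrite sqr_sqrtr ?ler0n// -natr1 addrK.
(* The value of [b] is forced by a + (s^2 - 1) b = 1. Taking a = 1/s keeps a^2 of the same order
   1/s^2 as the total (s^2 - 1) b^2 of the light pages. *)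
pose a : R := s^-1; pose b : R := (s * (s + 1))^-1.
have a_gt0 : 0 < a by rewrite invr_gt0.
have b_gt0 : 0 < b by rewrite invr_gt0 mulr_gt0.
have abE : a = (s + 1) * b.
  by rewrite /a /b; field; rewrite !lt0r_neq0.
have b_le_a : b <= a by rewrite abE; apply: ler_peMl; rewrite ?lerDr ltW.
pose gamma (n : 'I_N.+1) : R := if n == ord0 then a else b.
have gamma_sum (f : R -> R) : \sum_n f (gamma n) = f a + N%:R * f b.
  rewrite big_ord_recl /gamma eqxx; congr (_ + _).
  by rewrite (eq_bigr (fun=> f b))// sum_ord_const.
have gP : user_distribution gamma.
  split=> [n|]; first by rewrite /gamma; case: ifP.
  by rewrite (gamma_sum id) NE /a /b; field; rewrite !lt0r_neq0.
exists gamma; split=> //; split.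
  by exists (fun=> gamma); exact: pure_Nash_gamma.
exists (distinct_pages R N_gt0).
have optE : welfare gamma (distinct_pages R N_gt0) = a + b.
  by rewrite welfare_distinct_pages big_ord_recl big_ord1.
split.
  split=> [|q qP]; first exact: is_profile_distinct_pages.
  rewrite optE.
  (* Weight [b] is charged on all pages, whose total is at most 2, and only the excess a - b on the
     heavy page, capped at 1. *)
  have -> : welfare gamma q =
      (a - b) * page_welfare q ord0 + b * \sum_n page_welfare q n.
    have -> : welfare gamma q =
        a * page_welfare q ord0 + b * \sum_i page_welfare q (lift ord0 i).
      by rewrite [b * _]mulr_sumr [LHS]big_ord_recl.
    by rewrite big_ord_recl; ring.
  have w0 : (a - b) * page_welfare q ord0 <= a - b.
    by rewrite ler_piMr ?subr_ge0// page_welfare_le1.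
  have ws : b * \sum_n page_welfare q n <= b * 2.
    by rewrite ler_pM2l// sum_page_welfare_le.
  by lra.
apply: price_of_stability_ge => //.
rewrite optE (gamma_sum (fun x => x ^+ 2)) NE.
have -> : (a + b) / (a ^+ 2 + (s ^+ 2 - 1) * b ^+ 2) = 2^-1 * s + 1.
  rewrite /a /b; field; rewrite !lt0r_neq0//=.
  (* This is a^2 + (s^2 - 1) b^2 cleared of denominators, which must be nonzero. *)
  have -> : (s + 1) ^+ 2 + (s ^+ 2 - 1) = 2 * (s * (s + 1)) by ring.
  by rewrite !mulr_gt0.
by rewrite lerDl.
Qed.

Theorem proposition4p3 (R : realType) :
  (forall K : nat, (2 <= K)%N ->
     exists (N : nat) (gamma : 'I_N -> R),
       user_distribution gamma /\
       (exists D : profile R K N, pure_Nash 1 gamma D) /\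
       exists opt : profile R K N,
         welfare_maximizing gamma opt /\
         (K%:R%:E <= price_of_stability 1 gamma opt)%E)
  /\
  (exists (c : R) (N0 : nat), 0 < c /\
     forall N : nat, (N0 <= N)%N ->
       exists gamma : 'I_N -> R,
         user_distribution gamma /\
         (exists D : profile R 2 N, pure_Nash 1 gamma D) /\
         exists opt : profile R 2 N,
           welfare_maximizing gamma opt /\
           ((c * Num.sqrt N%:R)%:E <= price_of_stability 1 gamma opt)%E).
Proof.
split; first exact: uniform_instance.
(* The ratio is s/2 + 1, whence c = 1/2; showing distinct pages with two engines takes N >= 2. *)
exists 2^-1, 2%N; split; first by rewrite invr_gt0.
exact: one_heavy_page_instance.
Qed.
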